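(* Let $0 < \delta < 1$ and $0 < \alpha < \beta$ with $\frac{\alpha}{\beta} + \frac{\alpha}{2} \leq \frac{1}{2}$. Let $X_1, X_2, \ldots$ be a sequence of independent and identically distributed Bernoulli random variables having the same distribution as $X$, where $\Pr\{X = 1\} = 1 - \Pr\{X = 0\} = p \in (0,1)$. Define $$A = \frac{\beta}{(1+\beta)\ln(1+\beta) - \beta}\cdot\frac{\ln\frac{2}{\delta}}{\alpha}, \qquad B = \left(\frac{\alpha}{\beta} + \alpha\right) A.$$ Let $L$ and $W$ be real numbers such that $L \geq A$ and $W \geq B$. Define $$\boldsymbol{m} = \min\left\{ n \in \mathbb{N} : n > L \ \text{ or } \ \sum_{i=1}^n X_i > W \right\}, \qquad \widehat{\boldsymbol{p}} = \frac{1}{\boldsymbol{m}} \sum_{i=1}^{\boldsymbol{m}} X_i.$$ Then $$\Pr\left\{ |\widehat{\boldsymbol{p}} - p| < \alpha \ \text{ or } \ \left|\frac{\widehat{\boldsymbol{p}} - p}{p}\right| < \beta \right\} > 1 - \delta.$$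
   Context: $\mathbb{N}$ denotes the set of positive integers, $\ln$ the natural logarithm, and $\Pr\{\cdot\}$ the probability of an event. *)

(* Defs.v *)
From HB Require Import structures.
From mathcomp Require Import all_boot all_order all_algebra.
From mathcomp Require Import finmap all_classical all_reals all_analysis.

Set Implicit Arguments.
Unset Strict Implicit.
Unset Printing Implicit Defensive.

Import Order.TTheory GRing.Theory Num.Theory.
Import numFieldNormedType.Exports.

Local Open Scope classical_set_scope.
Local Open Scope ring_scope.

Definition mutually_independent (d : measure_display) (T : measurableType d)
    (R : realType) (P : probability T R) (I : choiceType)
    (X : I -> {RV P >-> R}) : Prop :=
  forall (J : {fset I}) (E : I -> set R),
    (forall i, measurable (E i)) ->
    P (\bigcap_(i in [set` J]) (X i @^-1` E i)) =
    (\prod_(i <- J) P (X i @^-1` E i))%E.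

Definition identically_distributed (d : measure_display) (T : measurableType d)
    (R : realType) (P : probability T R) (X Y : {RV P >-> R}) : Prop :=
  forall E : set R, measurable E -> distribution P X E = distribution P Y E.

Definition bernoulli_RV (d : measure_display) (T : measurableType d)
    (R : realType) (P : probability T R) (p : R) (X : {RV P >-> R}) : Prop :=
  P [set w | X w = 1] = p%:E /\ P [set w | X w = 0] = (1 - p)%:E.

Section stopping.
Context (R : realType).

(* The sequence x_1, x_2, ... is indexed from 0: [x i] is x_(i+1), so that
   [\sum_(i < n) x i] is x_1 + ... + x_n. *)
Definition stop_at (L W : R) (x : nat -> R) (n : nat) : bool :=
  (0 < n)%N && ((L < n%:R) || (W < \sum_(i < n) x i)).

Lemma stop_at_ex (L W : R) (x : nat -> R) : exists n, stop_at L W x n.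
Proof.
exists (Num.truncn `|L|).+1; apply/andP; split => //; apply/orP; left.
by rewrite (le_lt_trans (ler_norm L))// truncnS_gt.
Qed.

Definition stopping_time (L W : R) (x : nat -> R) : nat :=
  ex_minn (stop_at_ex L W x).

Definition stopped_mean (L W : R) (x : nat -> R) : R :=
  let m := stopping_time L W x in (m%:R)^-1 * \sum_(i < m) x i.

Definition sample_bound (alpha beta delta : R) : R :=
  beta / ((1 + beta) * ln (1 + beta) - beta) * (ln (2 / delta) / alpha).

Definition success_bound (alpha beta delta : R) : R :=
  (alpha / beta + alpha) * sample_bound alpha beta delta.

End stopping.

(* Main.v *)
(** With [t = ln (1 + beta)] or [t = - ln (1 + beta)], the process
    [exp (t * S_n - n * p * (exp t - 1))] is a supermartingale, because a
    Bernoulli variable has a smaller moment generating function than a Poisson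
    variable of the same mean. At a stopping time where the estimate is off by
    at least [max (alpha, beta * p)], one of the two processes exceeds
    [2 / delta]: upwards by the choice of [A] and [B], and downwards by the same
    choice since [2 * ln (1 + beta) <= beta + beta / (1 + beta)]. The
    optional stopping and Markov arguments are carried out together, by backward
    induction on the cylinders of sample paths that have not yet stopped. *)

Require Import Defs.
From HB Require Import structures.
From mathcomp Require Import all_boot all_order all_algebra.
From mathcomp Require Import finmap all_classical all_reals all_analysis.
From mathcomp Require Import measurable_realfun ring lra.

Set Implicit Arguments.
Unset Strict Implicit.
Unset Printing Implicit Defensive.

Import Order.TTheory GRing.Theory Num.Theory.
Import numFieldNormedType.Exports.

Local Open Scope classical_set_scope.
Local Open Scope ring_scope.

(** * Inequalities for [ln] and [expR], and the Bennett rate *)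

(** The difference of the two sides vanishes at 0 and is monotone, its derivative being a square
    over [expR y] up to sign. At [x = ln (1 + b)] it reads [2 * ln (1 + b) <= b + b / (1 + b)],
    which the lower deviation needs. *)
Lemma le_double_sinh (R : realType) (x : R) :
  0 <= x -> 2 * x <= expR x - expR (- x).
Proof.
move=> x0; pose f y : R := 2 * y + expR (- y) - expR y.
pose f' (y : R) : R := 2 - expR (- y) - expR y.
have df y : is_derive y (1 : R) f (f' y).
  rewrite /f /f'; apply: is_derive_eq.
  by rewrite !scaler1 /= mulrN1.
have : f x <= f 0.
  apply: (@ler0_derive1_nincry _ f 0) => //.
  - move=> y _; rewrite derive1E (@derive_val _ _ _ _ _ _ _ (df y)).
    rewrite /f' expRN; have e0 := expR_gt0 y.
    have : 0 <= (expR y - 1) ^+ 2 / expR y by rewrite divr_ge0 ?sqr_ge0 ?ltW.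
    have -> : (expR y - 1) ^+ 2 / expR y = expR y - 2 + (expR y)^-1.
      by field; rewrite gt_eqF.
    lra.
  - apply: continuous_subspaceT => z.
    exact/differentiable_continuous/derivable1_diffP.
by rewrite /f oppr0 expR0 mulr0; lra.
Qed.

Lemma ln1D_gt (R : realType) (b : R) : 0 < b -> b / (1 + b) < ln (1 + b).
Proof.
move=> b0; have b1 : 0 < 1 + b by lra.
have l0 : 0 < ln (1 + b) by rewrite ln_gt0; lra.
have := @expR_gt1Dx R (- ln (1 + b)).
rewrite oppr_eq0 gt_eqF// => /(_ isT); rewrite expRN lnK ?posrE//.
have -> : b / (1 + b) = 1 - (1 + b)^-1 by field; rewrite gt_eqF.
lra.
Qed.

(** This is [1 + x <= expR x] at [x = p * (expR t - 1)]; the right side is the Poisson moment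
    generating function. *)
Lemma bernoulli_mgf_le (R : realType) (p t : R) :
  p * expR t + (1 - p) <= expR (p * (expR t - 1)).
Proof. by apply: le_trans (expR_ge1Dx _); lra. Qed.

(** The large-deviation rate of a Poisson variable of mean 1 at the level [1 + b]; it is the
    denominator in [sample_bound]. *)
Definition bennett (R : realType) (b : R) : R := (1 + b) * ln (1 + b) - b.

Lemma bennett_gt0 (R : realType) (b : R) : 0 < b -> 0 < bennett b.
Proof.
by move=> b0; rewrite subr_gt0 mulrC -ltr_pdivrMr ?ln1D_gt//; lra.
Qed.

Lemma sample_boundE (R : realType) (a b delta : R) : 0 < a -> 0 < b ->
  sample_bound a b delta * (a / b * bennett b) = ln (2 / delta).
Proof.
move=> a0 b0; have := bennett_gt0 b0; rewrite /sample_bound /bennett => h0.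
by field; rewrite !gt_eqF.
Qed.

Lemma success_boundE (R : realType) (a b delta : R) : 0 < a -> 0 < b ->
  success_bound a b delta * bennett b = (1 + b) * ln (2 / delta).
Proof.
move=> a0 b0; rewrite /success_bound -(sample_boundE _ a0 b0).
by field; rewrite gt_eqF.
Qed.

(** * Deterministic deviation bounds at a stopping point *)

(** The conclusion bounds the exponent of the process at [t = ln (1 + b)], where [expR t - 1 = b].
    If [L < n], the exponent is at least [n * r * bennett b], using the relative deviation when
    [r <= p] and the absolute one when [p < r]. If [W < S], the bound [n * p <= S / (1 + b)] leaves
    at least [S * bennett b / (1 + b)]. *)
Lemma upper_deviation (R : realType) (r b p D L W n S : R) :
    0 < r -> 0 < b -> 0 < p ->
    D <= L * (r * bennett b) -> (1 + b) * D <= W * bennett b ->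
    0 < n -> L < n \/ W < S ->
    n * (p + r * b) <= S -> n * (p * (1 + b)) <= S ->
  D < ln (1 + b) * S - n * p * b.
Proof.
move=> r0 b0 p0 LD WD n0 LW Sa Sb.
have h0 := bennett_gt0 b0; move: h0 LD WD; rewrite /bennett.
have b1 : 0 < 1 + b by lra.
have l_le : ln (1 + b) <= b by rewrite le_ln1Dx//; lra.
have l0 : 0 < ln (1 + b) by rewrite ln_gt0; lra.
move: (ln _) l_le l0 => l l_le l0 h0 LD WD.
case: LW => [Ln|WS].
  have : D < n * (r * ((1 + b) * l - b)).
    by apply: le_lt_trans LD _; rewrite ltr_pM2r// mulr_gt0.
  move/lt_le_trans; apply.
  have [rp|pr] := leP r p.
    have : l * (n * (p * (1 + b))) <= l * S by rewrite ler_pM2l.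
    have : 0 <= n * ((p - r) * ((1 + b) * l - b)).
      by rewrite !mulr_ge0 ?subr_ge0// ltW// -subr_gt0.
    lra.
  have : l * (n * (p + r * b)) <= l * S by rewrite ler_pM2l.
  have : 0 <= n * ((r - p) * (b - l)) by rewrite !mulr_ge0 ?subr_ge0// ltW.
  lra.
rewrite -(ltr_pM2l b1).
have : W * ((1 + b) * l - b) < S * ((1 + b) * l - b) by rewrite ltr_pM2r.
have : b * (n * (p * (1 + b))) <= b * S by rewrite ler_pM2l.
lra.
Qed.

(** The mirror case [t = - ln (1 + b)], where [expR t - 1 = - (b / (1 + b))]. Its rate is
    [b / (1 + b) - ln (1 + b) * (1 - b)], which dominates [bennett b], so the same thresholds
    suffice. *)
Lemma lower_deviation (R : realType) (r b p D L W n S : R) :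
    0 < r -> 0 < b -> 0 < p -> 0 <= D ->
    D <= L * (r * bennett b) -> (1 + b) * D <= W * bennett b ->
    0 < n -> L < n \/ W < S ->
    S <= n * (p - r * b) -> S <= n * (p * (1 - b)) ->
  D < - ln (1 + b) * S + n * p * (b / (1 + b)).
Proof.
move=> r0 b0 p0 D0 LD WD n0 LW Sa Sb.
have h0 := bennett_gt0 b0.
have b1 : 0 < 1 + b by lra.
have l0 : 0 < ln (1 + b) by rewrite ln_gt0; lra.
have kl : b / (1 + b) <= ln (1 + b) by rewrite ltW// ln1D_gt.
have lk : 2 * ln (1 + b) <= b + b / (1 + b).
  have := le_double_sinh (ltW l0).
  rewrite expRN lnK ?posrE//; move/le_trans; apply.
  by rewrite le_eqVlt; apply/orP; left; apply/eqP; field; rewrite gt_eqF.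
have hk : bennett b <= b / (1 + b) - ln (1 + b) * (1 - b).
  by rewrite /bennett; lra.
move: (ln _) (_ / _) (bennett b) l0 kl lk hk h0 LD WD.
move=> l k h l0 kl lk hk h0 LD WD.
(* Both stopping causes follow from this one bound: [L < n] uses the [r] side of the maximum,
   [W < S] the [p] side. *)
have E : n * (Num.max r p * h) <= - l * S + n * p * k.
  have [rp|/ltW pr] := leP r p.
    have : l * S <= l * (n * (p * (1 - b))) by rewrite ler_pM2l.
    have : n * p * h <= n * p * (k - l * (1 - b)).
      by rewrite ler_pM2l// mulr_gt0.
    lra.
  have : l * S <= l * (n * (p - r * b)) by rewrite ler_pM2l.
  have : n * r * h <= n * r * (k - l * (1 - b)).
    by rewrite ler_pM2l// mulr_gt0.
  have : 0 <= n * ((r - p) * (l - k)) by rewrite !mulr_ge0 ?subr_ge0// ltW.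
  lra.
apply: lt_le_trans E.
case: LW => [Ln|WS].
  have : D < n * (r * h).
    by apply: le_lt_trans LD _; rewrite ltr_pM2r// mulr_gt0.
  move/lt_le_trans; apply.
  by rewrite ler_pM2l// ler_pM2r// le_max lexx.
have : n * (p * h) <= n * (Num.max r p * h).
  by rewrite ler_pM2l// ler_pM2r// le_max lexx orbT.
apply: lt_le_trans.
have : W * h < S * h by rewrite ltr_pM2r.
have : S * h <= n * (p * (1 - b)) * h by rewrite ler_pM2r.
have : 0 <= n * (p * b) * h by rewrite !mulr_ge0// ltW.
have : 0 <= b * D by rewrite mulr_ge0// ltW.
lra.
Qed.

(** * Locality and measurability of the stopping rule *)

Section stopping_theory.
Context (R : realType) (L W : R).
Implicit Types x y : nat -> R.

Lemma eq_stop_at x y n : (forall i, (i < n)%N -> x i = y i) ->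
  stop_at L W x n = stop_at L W y n.
Proof. by move=> xy; rewrite /stop_at (eq_bigr (fun i : 'I_n => y i))// => i _; exact: xy. Qed.

Lemma stopping_time_eqP x n :
  stopping_time L W x = n <->
  stop_at L W x n /\ forall k, (k < n)%N -> ~~ stop_at L W x k.
Proof.
rewrite /stopping_time; case: ex_minnP => m sm mmin; split=> [<-|[sn nmin]].
  by split=> // k; apply: contraTN => /mmin; rewrite -leqNgt.
apply/eqP; rewrite eqn_leq mmin//= leqNgt; apply: contraL sm; exact: nmin.
Qed.

(** Non-anticipation: whether the path stops at [n] depends on its first [n] terms only, so a
    stopped cylinder determines the stopping time. *)
Lemma eq_stopping_time x y n : (forall i, (i < n)%N -> x i = y i) ->
  stopping_time L W x = n -> stopping_time L W y = n.
Proof.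
move=> xy /stopping_time_eqP[sx xmin]; apply/stopping_time_eqP; split.
  by rewrite -(eq_stop_at xy).
move=> k kn; rewrite -(@eq_stop_at x) ?xmin// => i ik.
by rewrite xy// (ltn_trans ik).
Qed.

End stopping_theory.

Section measurability.
Context (R : realType) (L W : R) (d : measure_display) (T : measurableType d).
Context (Y : nat -> T -> R).
Hypothesis mY : forall i, measurable_fun setT (Y i).

Let S n w := \sum_(i < n) Y i w.
Let mS n : measurable_fun setT (S n).
Proof. by apply: measurable_sum. Qed.

Lemma measurable_stop_at n :
  measurable_fun setT (fun w => stop_at L W (Y ^~ w) n).
Proof.
apply: measurable_and; first exact: measurable_cst.
apply: measurable_or; first exact: measurable_cst.
by apply: measurable_fun_ltr => //; exact: mS.
Qed.

Lemma measurable_stopping_time n :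
  measurable [set w | stopping_time L W (Y ^~ w) = n].
Proof.
have mb (f : T -> bool) : measurable_fun setT f -> measurable [set w | f w].
  by move=> mf; rewrite -[X in measurable X]setTI; exact: mf.
rewrite (_ : [set _ | _] = [set w | stop_at L W (Y ^~ w) n] `&`
    \bigcap_(k in `I_n) ~` [set w | stop_at L W (Y ^~ w) k]).
  apply: measurableI; first exact/mb/measurable_stop_at.
  apply: bigcap_measurableType => k _; apply: measurableC.
  exact/mb/measurable_stop_at.
apply/seteqP; split=> w /=.
  by move/stopping_time_eqP => [sn smin]; split=> // k /smin/negP.
by move=> [sn smin]; apply/stopping_time_eqP; split=> // k kn; apply/negP/smin.
Qed.

Lemma measurable_stopped_mean :
  measurable_fun setT (fun w => stopped_mean L W (Y ^~ w)).
Proof.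
move=> _ E mE; rewrite setTI.
(* Splitting over the countably many values of the stopping time makes the number of summands
   deterministic. *)
rewrite (_ : _ @^-1` E = \bigcup_n ([set w | stopping_time L W (Y ^~ w) = n] `&`
    (fun w => n%:R^-1 * S n w) @^-1` E)).
  apply: bigcup_measurable => n _; apply: measurableI.
    exact: measurable_stopping_time.
  rewrite -[X in measurable X]setTI.
  by apply: (measurable_funM (measurable_cst _) (mS n)).
apply/seteqP; split=> w /=; rewrite /stopped_mean.
  by move=> Ew; exists (stopping_time L W (Y ^~ w)).
by move=> [n _ /= [-> ]].
Qed.

End measurability.

(** * Exponential supermartingales on finite bit strings *)

(** A finite path extended by zeros, so that [stop_at] applies to it; the padding is never read at
    times up to [size s]. *)
Definition bit (R : realType) (s : seq bool) (i : nat) : R := (nth false s i)%:R.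

Definition tilted (R : realType) (p t : R) (s : seq bool) : R :=
  expR (t * \sum_(i < size s) bit R s i - (size s)%:R * p * (expR t - 1)).

Lemma sum_bit_rcons (R : realType) (s : seq bool) (b : bool) :
  \sum_(i < size (rcons s b)) bit R (rcons s b) i =
  \sum_(i < size s) bit R s i + b%:R.
Proof.
rewrite size_rcons big_ord_recr/= /bit nth_rcons ltnn eqxx; congr (_ + _).
by apply: eq_bigr => i _; rewrite nth_rcons ltn_ord.
Qed.

Lemma tilted_rcons (R : realType) (p t : R) (s : seq bool) (b : bool) :
  tilted p t (rcons s b) =
  tilted p t s * ((if b then expR t else 1) / expR (p * (expR t - 1))).
Proof.
rewrite /tilted sum_bit_rcons size_rcons.
have -> : (if b then expR t else 1) = expR (t * b%:R).
  by case: b; rewrite ?mulr1// mulr0 expR0.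
rewrite -expRN -!expRD; congr expR.
by rewrite -natr1; ring.
Qed.

(** The left side averages over the next bit; each step multiplies by the ratio of the Bernoulli to
    the Poisson generating function, which is at most 1. *)
Lemma tilted_supermartingale (R : realType) (p t : R) (s : seq bool) :
  p * tilted p t (rcons s true) + (1 - p) * tilted p t (rcons s false) <=
  tilted p t s.
Proof.
rewrite !tilted_rcons; set e := expR (p * _).
have -> : p * (tilted p t s * (expR t / e)) + (1 - p) * (tilted p t s * (1 / e))
  = tilted p t s * ((p * expR t + (1 - p)) / e) by ring.
rewrite ler_piMr ?expR_ge0// ler_pdivrMr ?expR_gt0// mul1r.
exact: bernoulli_mgf_le.
Qed.

Lemma bad_stop_tilted (R : realType) (delta a b p L W : R) (s : seq bool) :
    0 < delta < 1 -> 0 < a -> 0 < b -> 0 < p ->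
    sample_bound a b delta <= L -> success_bound a b delta <= W ->
    stop_at L W (bit R s) (size s) ->
    let q := (size s)%:R^-1 * \sum_(i < size s) bit R s i in
    ~ (`|q - p| < a \/ `|(q - p) / p| < b) ->
  2 / delta < tilted p (ln (1 + b)) s + tilted p (- ln (1 + b)) s.
Proof.
move=> /andP[d0 d1] a0 b0 p0 LA WB; rewrite /tilted /stop_at.
move: (size s) (\sum_(i < _) _) => m S /andP[m_gt0 LW]; set q := _^-1 * S.
have n0 : 0 < (m%:R : R) by rewrite ltr0n.
have {LW} LW : L < m%:R \/ W < S by exact/orP.
have SE : S = m%:R * q by rewrite /q mulVKf // gt_eqF.
move: (m%:R : R) n0 LW q SE => {m m_gt0} n n0 LW q SE.
move=> /not_orP[/negP]; rewrite -leNgt => qa /negP; rewrite -leNgt.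
rewrite normrM normfV (gtr0_norm p0) ler_pdivlMr// => qb.
(* The ratio [a / b] is the value of [p] at which the absolute and relative tolerances coincide. *)
have r0 : 0 < a / b by exact: divr_gt0.
have aE : a / b * b = a by rewrite divfK// gt_eqF.
have D2 : 1 < 2 / delta by rewrite ltr_pdivlMr//; lra.
have D0 : 0 <= ln (2 / delta) by rewrite ln_ge0// ltW.
have LD : ln (2 / delta) <= L * (a / b * bennett b).
  by rewrite -(sample_boundE _ a0 b0) ler_pM2r// mulr_gt0// bennett_gt0.
have WD : (1 + b) * ln (2 / delta) <= W * bennett b.
  by rewrite -(success_boundE _ a0 b0) ler_pM2r// bennett_gt0.
have -> : 2 / delta = expR (ln (2 / delta)) by rewrite lnK// posrE; lra.
have b1 : 0 < 1 + b by lra.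
have [pq|/ltW qp] := leP p q.
  move: qa qb; rewrite ger0_norm ?subr_ge0// => qa qb.
  have Sa : n * (p + a / b * b) <= S by rewrite aE SE ler_pM2l//; lra.
  have Sb : n * (p * (1 + b)) <= S by rewrite SE ler_pM2l//; lra.
  rewrite ltr_pwDr ?expR_gt0// ler_expR lnK ?posrE//.
  apply: le_trans (ltW (upper_deviation r0 b0 p0 LD WD n0 LW Sa Sb)) _.
  by rewrite (addrC 1) addrK.
move: qa qb; rewrite ler0_norm ?subr_le0// => qa qb.
have Sa : S <= n * (p - a / b * b) by rewrite aE SE ler_pM2l//; lra.
have Sb : S <= n * (p * (1 - b)) by rewrite SE ler_pM2l//; lra.
rewrite ltr_pwDl ?expR_gt0// ler_expR expRN lnK ?posrE//.
apply: le_trans (ltW (lower_deviation r0 b0 p0 D0 LD WD n0 LW Sa Sb)) _.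
rewrite le_eqVlt; apply/orP; left; apply/eqP; field.
by rewrite gt_eqF.
Qed.

(** * Cylinders of sample paths and their probabilities *)

Section bernoulli_sequence.
Context (R : realType) (d : measure_display) (T : measurableType d)
  (P : probability T R) (p : R) (Xs : nat -> {RV P >-> R}).

Definition cylinder (s : seq bool) : set T :=
  [set w | forall i, (i < size s)%N -> Xs i w = bit R s i].

Lemma cylinderE (s : seq bool) : cylinder s =
  \bigcap_(i in [set` [fset i | i in iota 0 (size s)]%fset])
    (Xs i @^-1` [set bit R s i]).
Proof.
apply/seteqP; split=> w /= ws i.
  by rewrite /= in_fset /= mem_iota => /ws.
by move=> si; apply: ws; rewrite /= in_fset /= mem_iota.
Qed.

Lemma measurable_cylinder (s : seq bool) : measurable (cylinder s).
Proof.
rewrite cylinderE; apply: bigcap_measurableType => i _.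
rewrite -[X in measurable X]setTI.
exact: (measurable_funPT (Xs i)).
Qed.

Lemma cylinder_nil : cylinder [::] = setT.
Proof. by apply/seteqP; split. Qed.

Lemma cylinder_rcons (s : seq bool) (b : bool) :
  cylinder (rcons s b) = cylinder s `&` [set w | Xs (size s) w = b%:R].
Proof.
apply/seteqP; split=> w /=.
  move=> ws; split=> [i si|]; first by rewrite ws ?size_rcons 1?ltnW// /bit nth_rcons si.
  by rewrite ws ?size_rcons// /bit nth_rcons ltnn eqxx.
move=> [ws wb] i; rewrite size_rcons ltnS leq_eqVlt => /predU1P[->|si].
  by rewrite /bit nth_rcons ltnn eqxx.
by rewrite ws// /bit nth_rcons si.
Qed.

Definition bit_prob (b : bool) : R := if b then p else 1 - p.

Lemma prob_cylinder (X : {RV P >-> R}) (s : seq bool) :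
    bernoulli_RV p X -> (forall i, identically_distributed (Xs i) X) ->
    mutually_independent Xs ->
  P (cylinder s) = (\prod_(b <- s) bit_prob b)%:E.
Proof.
move=> [X1 X0] XsX ind; rewrite cylinderE ind//.
rewrite (perm_big (iota 0 (size s))); last first.
  apply: uniq_perm; rewrite ?iota_uniq ?fset_uniq// => i.
  by rewrite in_fset /=.
rewrite -prodEFin (big_nth false) /index_iota subn0; apply: eq_bigr => i _.
have := XsX i [set bit R s i] (measurable_set1 _).
rewrite /distribution /= /pushforward => ->.
by rewrite /bit /bit_prob; case: nth.
Qed.

Lemma stopped_mean_cylinder (L W : R) (s : seq bool) (w : T) :
    stop_at L W (bit R s) (size s) ->
    (forall k, (k < size s)%N -> ~~ stop_at L W (bit R s) k) ->
    cylinder s w ->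
  stopped_mean L W (fun i => Xs i w) =
  (size s)%:R^-1 * \sum_(i < size s) bit R s i.
Proof.
move=> ss smin ws; rewrite /stopped_mean.
rewrite (@eq_stopping_time _ L W (bit R s) _ (size s)).
- by congr (_ * _); apply: eq_bigr => i _; exact: ws.
- by move=> i si; rewrite ws.
- exact/stopping_time_eqP.
Qed.

End bernoulli_sequence.

(** * Backward induction and conclusion *)

(** Induction on the number [n] of draws left before the deterministic horizon [N]. Bounding the
    good event from below requires only that the two extensions of a cylinder be disjoint and
    contained in it, not that they cover it. *)
Lemma prob_good_cylinder (R : realType) (d : measure_display)
    (T : measurableType d) (P : probability T R) (delta a b p L W : R)
    (X : {RV P >-> R}) (Xs : nat -> {RV P >-> R}) (N : nat)
    (G := [set w | let q := stopped_mean L W (fun i => Xs i w) in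
      `|q - p| < a \/ `|(q - p) / p| < b]) :
    0 < delta < 1 -> 0 < a -> 0 < b -> 0 < p < 1 ->
    sample_bound a b delta <= L -> success_bound a b delta <= W ->
    bernoulli_RV p X -> (forall i, identically_distributed (Xs i) X) ->
    mutually_independent Xs ->
    (0 < N)%N -> L < N%:R -> measurable G ->
  forall n s, (size s + n = N)%N ->
    (forall k, (k < size s)%N -> ~~ stop_at L W (bit R s) k) ->
  ((\prod_(b <- s) bit_prob p b * (1 - delta / 2 *
    (tilted p (ln (1 + b)) s + tilted p (- ln (1 + b)) s)))%:E <
  P (G `&` cylinder Xs s))%E.
Proof.
move=> d01 a0 b0 /andP[p0 p1] LA WB XB XsX ind N0 LN mG.
pose Y s := tilted p (ln (1 + b)) s + tilted p (- ln (1 + b)) s.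
have Y0 s : 0 < Y s by rewrite addr_gt0// expR_gt0.
have w0 s : 0 < \prod_(b <- s) bit_prob p b :> R.
  by apply: prodr_gt0 => -[] _ //=; rewrite /bit_prob subr_gt0.
have d0 : 0 < delta by case/andP: d01.
have stopped s : stop_at L W (bit R s) (size s) ->
    (forall k, (k < size s)%N -> ~~ stop_at L W (bit R s) k) ->
  ((\prod_(b <- s) bit_prob p b * (1 - delta / 2 * Y s))%:E <
  P (G `&` cylinder Xs s))%E.
  move=> ss smin; set q := (size s)%:R^-1 * \sum_(i < size s) bit R s i.
  have qE w : cylinder Xs s w -> stopped_mean L W (fun i => Xs i w) = q.
    exact: stopped_mean_cylinder.
  have [good|bad] := pselect (`|q - p| < a \/ `|(q - p) / p| < b).
    rewrite (_ : _ `&` _ = cylinder Xs s).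
      rewrite (prob_cylinder s XB XsX ind) lte_fin gtr_pMr// ltrBlDr ltrDl.
      by rewrite mulr_gt0// divr_gt0.
    by apply/seteqP; split=> w /=; [case|move=> ws; split=> //; rewrite /G /= qE].
  (* At a bad stop the two processes sum to more than [2 / delta], so the claimed lower bound is
     negative. *)
  apply: lt_le_trans (measure_ge0 _ _); rewrite lte_fin pmulr_rlt0// subr_lt0.
  rewrite -ltr_pdivrMl ?divr_gt0// mulr1 invf_div.
  exact: (bad_stop_tilted d01 a0 b0 p0 LA WB ss bad).
elim=> [|n IHn] s sN smin.
  apply: stopped => //; move: sN; rewrite addn0 => ->.
  by rewrite /stop_at N0 LN.
have [ss|nss] := boolP (stop_at L W (bit R s) (size s)); first exact: stopped.
have IH b' : ((\prod_(b <- rcons s b') bit_prob p b *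
    (1 - delta / 2 * Y (rcons s b')))%:E < P (G `&` cylinder Xs (rcons s b')))%E.
  apply: IHn; first by rewrite size_rcons addSnnS.
  move=> k; rewrite size_rcons ltnS => ks.
  (* For [k <= size s] the appended bit is not among the first [k], so the test is the one for
     [s]. *)
  rewrite (@eq_stop_at _ _ _ _ (bit R s)); last first.
    by move=> i ik; rewrite /bit nth_rcons (leq_trans ik ks).
  by move: ks; rewrite leq_eqVlt => /predU1P[->//|/smin].
have mc s' : measurable (G `&` cylinder Xs s').
  by apply: measurableI => //; exact: measurable_cylinder.
have : (P (G `&` cylinder Xs (rcons s true)) +
    P (G `&` cylinder Xs (rcons s false)) <= P (G `&` cylinder Xs s))%E.
  rewrite -measureU//; last first.
    apply/seteqP; split=> w //=; rewrite !cylinder_rcons => -[[_ [_ /= ->]]].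
    by move=> [_ [_ /= /eqP]]; rewrite oner_eq0.
  apply: le_measure; rewrite ?inE//; first exact: measurableU.
  by rewrite !cylinder_rcons => w [] [? []].
apply: lt_le_trans; apply: le_lt_trans (lteD (IH true) (IH false)).
rewrite -EFinD lee_fin -!cats1 !big_cat/= !big_seq1 !cats1 /bit_prob.
have := tilted_supermartingale p (ln (1 + b)) s.
have := tilted_supermartingale p (- ln (1 + b)) s.
have := w0 s; rewrite /Y.
move: (\prod_(_ <- _) _) (tilted _ _ s) (tilted _ (- _) s) => w y z.
move: (tilted _ _ _) (tilted _ _ _) (tilted _ _ _) (tilted _ _ _) => y1 y2 z1 z2.
move=> w_gt0 h1 h2.
(* The weighted slack of the two supermartingale inequalities is exactly the gap between the bound
   at [s] and the sum of those at its extensions. *)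
have : 0 <= w * (delta / 2) *
    ((z - (p * z2 + (1 - p) * z1)) + (y - (p * y2 + (1 - p) * y1))).
  apply: mulr_ge0; first by rewrite mulr_ge0 ?divr_ge0// ltW.
  by rewrite addr_ge0// subr_ge0.
lra.
Qed.

Theorem theorem2 (R : realType) (d : measure_display) (T : measurableType d)
    (P : probability T R) (delta alpha beta p L W : R)
    (X : {RV P >-> R}) (Xs : nat -> {RV P >-> R})
    (delta01 : 0 < delta < 1) (alpha_gt0 : 0 < alpha)
    (alpha_lt_beta : alpha < beta)
    (alpha_beta : alpha / beta + alpha / 2 <= 1 / 2)
    (p01 : 0 < p < 1) (X_bernoulli : bernoulli_RV p X)
    (Xs_X : forall i, identically_distributed (Xs i) X)
    (Xs_indep : mutually_independent Xs)
    (L_ge : sample_bound alpha beta delta <= L)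
    (W_ge : success_bound alpha beta delta <= W) :
  let phat := fun w : T => stopped_mean L W (fun i => Xs i w) in
  ((1 - delta)%:E <
     P [set w | `|phat w - p| < alpha \/ `|(phat w - p) / p| < beta]%R)%E.
Proof.
pose phat w := stopped_mean L W (fun i => Xs i w).
have b0 : 0 < beta by rewrite (lt_trans alpha_gt0).
pose N := (Num.truncn `|L|).+1.
have LN : L < N%:R by rewrite (le_lt_trans (ler_norm L))// truncnS_gt.
have mphat : measurable_fun setT phat.
  by apply: measurable_stopped_mean => i; exact: measurable_funPT.
have mG : measurable [set w | `|phat w - p| < alpha \/ `|(phat w - p) / p| < beta].
  have mb (f : T -> R) c : measurable_fun setT f -> measurable [set w : T | `|f w| < c].
    move=> mf; rewrite -[X in measurable X]setTI.
    have := measurable_fun_ltr (measurableT_comp (@normr_measurable R setT) mf)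
      (measurable_cst c).
    by move=> /(_ measurableT [set true]); exact.
  apply: measurableU; apply: mb.
    exact: measurable_funB.
  by apply: measurable_funM => //; exact: measurable_funB.
(* At the empty path both processes equal 1, so the bound is [1 - delta / 2 * (1 + 1)]. *)
have := @prob_good_cylinder R d T P delta alpha beta p L W X Xs N.
move=> /(_ delta01 alpha_gt0 b0 p01 L_ge W_ge X_bernoulli Xs_X Xs_indep).
move=> /(_ isT LN mG N [::] (add0n N)) /=.
rewrite cylinder_nil setIT big_nil mul1r /tilted/= big_ord0.
rewrite !mulr0 !mul0r subrr expR0.
rewrite (_ : delta / 2 * (1 + 1) = delta); last by field.
by apply.
Qed.
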